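(* Let $n\geq 2$ and let $BH_n$ be the $n$-dimensional balanced hypercube with bipartition $(V_0,V_1)$. Let $S=\{s_1,\dots,s_{2n-2}\}\subseteq V_0$ and $T=\{t_1,\dots,t_{2n-2}\}\subseteq V_1$ be sets of $2n-2$ distinct vertices each. Then there exist a permutation $\psi$ of $\{1,\dots,2n-2\}$ and pairwise vertex-disjoint paths $P_1,\dots,P_{2n-2}$ in $BH_n$ such that $P_i$ joins $s_i$ to $t_{\psi(i)}$ for each $i$ and $V(P_1)\cup\dots\cup V(P_{2n-2})=V(BH_n)$ (i.e., $BH_n$ has an unpaired $(2n-2)$-disjoint path cover joining $S$ and $T$).
   Context: The $n$-dimensional balanced hypercube $BH_n$ ($n\ge 1$) has vertex set $\{(a_0,a_1,\dots,a_{n-1}) : a_i\in\{0,1,2,3\}\}$ ($4^n$ vertices). A vertex $v=(a_0,\dots,a_{n-1})$ is adjacent to exactly the following $2n$ vertices: $((a_0\pm 1)\bmod 4, a_1,\dots,a_{n-1})$, and, for each $1\le i\le n-1$, $((a_0\pm1)\bmod 4, a_1,\dots,a_{i-1},(a_i+(-1)^{a_0})\bmod 4,a_{i+1},\dots,a_{n-1})$. $BH_n$ is bipartite with bipartition $V_0$ (vertices with even first coordinate $a_0$) and $V_1$ (vertices with odd first coordinate $a_0$). *)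

(* Defs.v *)
From mathcomp Require Import all_boot all_fingroup.
Set Implicit Arguments. Unset Strict Implicit. Unset Printing Implicit Defensive.

Definition bh_vertex (n : nat) := {ffun 'I_n -> 'I_4}.

Definition m4 (k : nat) : nat := k %% 4.

(* the first coordinate a_0 (0 if n = 0; only used with n >= 1) *)
Definition a0 n (v : bh_vertex n) : nat :=
  match n as m return bh_vertex m -> nat with
  | 0 => fun _ => 0
  | m.+1 => fun v => nat_of_ord (v ord0)
  end v.

(* (a_i + (-1)^{a_0}) mod 4 *)
Definition bh_shift (a0v ai : nat) : nat :=
  if odd a0v then m4 (ai + 3) else m4 (ai + 1).

Definition bh_adj n (v u : bh_vertex n) : bool :=
  ((a0 u == m4 (a0 v + 1)) || (a0 u == m4 (a0 v + 3))) &&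
  ([forall j : 'I_n, (0 < j) ==> (nat_of_ord (u j) == v j)] ||
   [exists i : 'I_n, (0 < i) &&
      (nat_of_ord (u i) == bh_shift (a0 v) (v i)) &&
      [forall j : 'I_n, ((0 < j) && (j != i)) ==> (nat_of_ord (u j) == v j)]]).

Definition in_V0 n (v : bh_vertex n) : bool := ~~ odd (a0 v).
Definition in_V1 n (v : bh_vertex n) : bool := odd (a0 v).

Definition is_bh_path n (x : bh_vertex n) (p : seq (bh_vertex n)) : bool :=
  path (@bh_adj n) x p && uniq (x :: p).

Definition unpaired_dpc n k (s t : 'I_k -> bh_vertex n) : Prop :=
  exists (psi : 'S_k) (p : 'I_k -> seq (bh_vertex n)),
    [/\ forall i, is_bh_path (s i) (p i),
        forall i, last (s i) (p i) = t (psi i),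
        forall i j, i != j -> forall v, v \in s i :: p i -> v \notin s j :: p j
      & forall v : bh_vertex n, exists i, v \in s i :: p i].

(* Main.v *)
Require Import Defs.
From mathcomp Require Import all_boot all_fingroup ssralg zmodp zify.
Set Implicit Arguments. Unset Strict Implicit. Unset Printing Implicit Defensive.
Import GRing.Theory.

(** The vertices with first coordinates [a_0] and [a_0 + 2] are twins, so [BH_n]
    is the blow-up by pairs of twins of the bipartite graph on two copies of
    [X = Z_4^(n-1)] in which a white [x] is adjacent to the blacks [x] and
    [x + e_i]; whites and blacks are both labelled by [bool * X].
    A path cover from [S] to [T] is given by a perfect matching [f] of [BH_n] and
    a matching [h] of [V_0 - S] onto [V_1 - T], extended by a bijection from [S]
    to [T], such that all cycles of [f * h^-1] meet [S].
    The matching [h] exists by Hall's theorem, because a nonempty [W] in [X] whose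
    neighbourhood [N W] is not [X] satisfies [#|N W| >= #|W| + (n - 1)].
    For [f] take a lift of a Hamiltonian cycle [x, gray x, gray (gray x), ...] of
    [X], given by a Gray code.  Exchanging the [f]-partners of two twins lying in
    different cycles of [f * h^-1] merges these cycles; since the lifted cycle is
    connected, such exchanges lead to a single cycle, which is then cut at the
    edges from [T] to [S]. *)

(** * Neighbourhoods and Hall's theorem *)

Definition nbhd (A B : finType) (r : A -> B -> bool) (J : {set A}) : {set B} :=
  [set b | [exists a in J, r a b]].

Lemma nbhdP (A B : finType) (r : A -> B -> bool) (J : {set A}) b :
  reflect (exists2 a, a \in J & r a b) (b \in nbhd r J).
Proof. by rewrite inE; apply: (iffP exists_inP). Qed.

Lemma nbhdU (A B : finType) (r : A -> B -> bool) (J K : {set A}) :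
  nbhd r (J :|: K) = nbhd r J :|: nbhd r K.
Proof.
apply/setP=> b; rewrite in_setU; apply/nbhdP/orP.
  by case=> a /setUP[aJ|aK] rab; [left|right]; apply/nbhdP; exists a.
by case=> /nbhdP[a aJ rab]; exists a => //; rewrite inE aJ ?orbT.
Qed.

(** Induction on [#|D|]: a tight nonempty proper subset [J] is matched separately from [D :\: J]; if
    there is none, any single edge may be fixed first. The value [b0] supplies a map when [D] is
    empty. *)
Theorem hall_marriage (A B : finType) (b0 : B) (r : A -> B -> bool)
    (D : {set A}) (R : {set B}) :
  (forall J : {set A}, J \subset D -> #|J| <= #|nbhd r J :&: R|) ->
  exists f : A -> B, {in D &, injective f} /\
    {in D, forall a, (f a \in R) && r a (f a)}.
Proof.
have [k] := ubnP #|D|; elim: k => // k IHk in D R *; rewrite ltnS => leDk hallD.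
have [-> | [a aD]] := set_0Vmem D.
  by exists (fun=> b0); split=> a; rewrite inE.
case: (pickP [pred J : {set A} | [&& J \proper D, J != set0
                                 & #|nbhd r J :&: R| <= #|J|]]) => [J | loose].
  case/and3P=> prJ J0 tight; have sJD := proper_sub prJ.
  have ltJ : #|J| < k by exact: leq_trans (proper_card prJ) leDk.
  have [K sKJ|f1 [inj1 f1P]] := IHk _ R ltJ.
    by apply: hallD; apply: subset_trans sJD.
  have ltDJ : #|D :\: J| < k.
    apply: leq_trans leDk; rewrite -(cardsID J D) (setIidPr sJD).
    by rewrite -[X in X < _]add0n ltn_add2r card_gt0.
  (* Hall's condition for [J :|: K], minus the at most [#|J|] neighbours of the tight set [J], is
     the condition for [K]. *)
  have [K sK|f2 [inj2 f2P]] := IHk _ (R :\: nbhd r J) ltDJ.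
    have sKD : K \subset D by apply: subset_trans sK _; apply: subsetDl.
    have dJK : [disjoint J & K].
      by rewrite disjoint_sym; apply: disjointWl sK _; rewrite disjoints_subset subsetDr.
    have := hallD (J :|: K); rewrite subUset sJD sKD => /(_ isT).
    rewrite cardsU disjoint_setI0 // cards0 subn0 nbhdU.
    have -> : (nbhd r J :|: nbhd r K) :&: R =
              (nbhd r J :&: R) :|: (nbhd r K :&: (R :\: nbhd r J)).
      by apply/setP=> b; rewrite !in_setI !in_setU !in_setI in_setD; do 3!case: (b \in _).
    move=> le1; have le2 := leq_trans le1 (leq_card_setU _ _).
    by rewrite -(leq_add2l #|J|); apply: leq_trans le2 _; rewrite leq_add2r.
  have f1N x : x \in J -> f1 x \in nbhd r J.
    by move=> xJ; apply/nbhdP; exists x => //; case/andP: (f1P x xJ).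
  have f2N x : x \in D -> x \notin J -> f2 x \notin nbhd r J.
    by move=> xD xJ; have /f2P : x \in D :\: J by [rewrite inE xJ]; rewrite in_setD => /andP[/andP[]].
  exists (fun x => if x \in J then f1 x else f2 x); split=> [x y xD yD /=|x xD].
    case: ifPn => xJ; case: ifPn => yJ; first exact: inj1.
    - by move=> Exy; have := f2N _ yD yJ; rewrite -Exy f1N.
    - by move=> Exy; have := f2N _ xD xJ; rewrite Exy f1N.
    by apply: inj2; rewrite inE ?xJ ?yJ.
  case: ifPn => xJ; first exact: f1P.
  by have /f2P : x \in D :\: J by [rewrite inE xJ]; rewrite in_setD => /andP[/andP[_ ->] ->].
have /card_gt0P[b /setIP[/nbhdP[_ /set1P-> rab] bR]] : 0 < #|nbhd r [set a] :&: R|.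
  by rewrite -(cards1 a); apply: hallD; rewrite sub1set.
have prD : D :\ a \proper D by rewrite properD1.
have [||f [injf fP]] := IHk (D :\ a) (R :\ b); first exact: leq_trans (proper_card prD) leDk.
  move=> K sK; have [->|K0] := eqVneq K set0; first by rewrite cards0.
  have := loose K; rewrite /= K0 (sub_proper_trans sK prD) /= => /negbT; rewrite -ltnNge.
  rewrite setIDA (cardsD1 b (nbhd r K :&: R)) => lt1.
  by rewrite -ltnS; apply: leq_trans lt1 _; rewrite -add1n leq_add2r leq_b1.
have fb x : x \in D -> x != a -> f x != b.
  by move=> xD xa; have /fP : x \in D :\ a by [rewrite !inE xa]; rewrite in_setD1 => /andP[/andP[]].
exists (fun x => if x == a then b else f x); split=> [x y xD yD /=|x xD].
  case: eqVneq => [->|xa]; case: eqVneq => [->|ya] // Exy.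
  - by have := fb _ yD ya; rewrite -Exy eqxx.
  - by have := fb _ xD xa; rewrite Exy eqxx.
  by apply: injf; rewrite // !inE ?xa ?ya.
case: eqVneq => [->|xa]; first by rewrite bR.
by have /fP : x \in D :\ a by [rewrite !inE xa]; rewrite in_setD1 => /andP[/andP[_ ->] ->].
Qed.

(** * Merging cycles by swapping twins *)

Lemma merge_porbits_tpermL (U : finType) (s : {perm U}) x y :
  x \notin porbit s y -> #|porbits (tperm x y * s)| < #|porbits s|.
Proof.
move=> xy; have := porbits_mul_tperm s x y; rewrite xy.
have -> : x != y by apply: contraNneq xy => ->; rewrite porbit_id.
by move=> /= E; rewrite -ltnS -[X in _ < X]addn1 -E -addnn addnA !addn1.
Qed.

Lemma merge_porbits_tpermR (U : finType) (s : {perm U}) x y :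
  x \notin porbit s y -> #|porbits (s * tperm x y)| < #|porbits s|.
Proof.
move=> xy; rewrite -porbitsV invMg tpermV -(porbitsV s).
by apply: merge_porbits_tpermL; rewrite porbitV.
Qed.

(* [f] matches whites with blacks and projects onto the cycle of edges [x -- x],
   [x -- next x]: each of the two is used by one of the two twins over [x]. *)
Definition lifts_cycle (X : finType) (e : rel X) (next : X -> X)
    (f : {perm bool * X}) : bool :=
  [forall x, exists i, (f (i, x)).2 == x] &&
  [forall x, exists i, (f (i, x)).2 == next x] &&
  [forall u, e u.2 (f u).2].

Lemma tperm_twin (X : finType) (x : X) (u : bool * X) :
  (tperm (true, x) (false, x) u).2 = u.2.
Proof. by case: tpermP => [->|->|]. Qed.

Lemma lifts_cycle_tpermL (X : finType) (e : rel X) next (f : {perm bool * X}) x :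
  lifts_cycle e next f -> lifts_cycle e next (tperm (true, x) (false, x) * f).
Proof.
case/andP=> /andP[/forallP f0 /forallP f1] /forallP fe; set t := tperm _ _.
(* The new witness is the twin index that the swap sends to the old one. *)
have tE i y : t ((t (i, y)).1, y) = (i, y).
  have -> : ((t (i, y)).1, y) = t (i, y) by rewrite [RHS]surjective_pairing tperm_twin.
  exact: tpermK.
apply/andP; split; first (apply/andP; split).
- apply/forallP=> y; have /existsP[i /eqP fi] := f0 y.
  by apply/existsP; exists (t (i, y)).1; rewrite permM tE fi.
- apply/forallP=> y; have /existsP[i /eqP fi] := f1 y.
  by apply/existsP; exists (t (i, y)).1; rewrite permM tE fi.
by apply/forallP=> u; have := fe (t u); rewrite permM tperm_twin.
Qed.

Lemma lifts_cycle_tpermR (X : finType) (e : rel X) next (f : {perm bool * X}) x :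
  lifts_cycle e next f -> lifts_cycle e next (f * tperm (true, x) (false, x)).
Proof.
case/andP=> /andP[/forallP f0 /forallP f1] /forallP fe.
apply/andP; split; first (apply/andP; split).
- by apply/forallP=> y; under eq_existsb => i do rewrite permM tperm_twin.
- by apply/forallP=> y; under eq_existsb => i do rewrite permM tperm_twin.
by apply/forallP=> u; rewrite permM tperm_twin.
Qed.

(* A lift minimising the number of cycles of [f * h^-1] is transitive: two twins
   in different cycles could be swapped, which merges these cycles; so every
   cycle is a union of twin classes, and these classes are closed under [next]. *)
Lemma lifts_cycle_transitive (X : finType) (e : rel X) (next : X -> X)
    (f0 h : {perm bool * X}) :
  (forall A : {set X}, A != set0 -> (forall x, x \in A -> next x \in A) ->
     A = setT) ->
  lifts_cycle e next f0 ->
  exists2 f, lifts_cycle e next f & forall u v, v \in porbit (f * h^-1) u.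
Proof.
move=> connX lf0.
case: (arg_minnP (fun f : {perm bool * X} => #|porbits (f * h^-1)|) lf0) => f lf minf.
exists f => // u0 v0.
have white i j x : ((i, x) \in porbit (f * h^-1) u0) = ((j, x) \in porbit (f * h^-1) u0).
  have tw : (true, x) \in porbit (f * h^-1) (false, x).
    apply/contraT=> /merge_porbits_tpermL; rewrite mulgA ltnNge minf //.
    exact: lifts_cycle_tpermL.
  have E : porbit (f * h^-1) (true, x) = porbit (f * h^-1) (false, x).
    by apply/eqP; rewrite eq_porbit_mem.
  by rewrite -!eq_porbit_mem; case: i; case: j; rewrite ?E.
(* Black twins are seen through their [h]-partners: swapping the twins after [f] multiplies
   [f * h^-1] on the right by the transposition of these partners. *)
have black i j x : ((h^-1)%g (i, x) \in porbit (f * h^-1) u0) = ((h^-1)%g (j, x) \in porbit (f * h^-1) u0).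
  have tw : (h^-1)%g (true, x) \in porbit (f * h^-1) ((h^-1)%g (false, x)).
    apply/contraT=> /merge_porbits_tpermR; rewrite -tpermJ conjgE invgK mulgA mulgKV.
    by rewrite mulgA ltnNge minf // lifts_cycle_tpermR.
  have E : porbit (f * h^-1) ((h^-1)%g (true, x)) = porbit (f * h^-1) ((h^-1)%g (false, x)).
    by apply/eqP; rewrite eq_porbit_mem.
  by rewrite -!eq_porbit_mem; case: i; case: j; rewrite ?E.
have image u : ((h^-1)%g (f u) \in porbit (f * h^-1) u0) = (u \in porbit (f * h^-1) u0).
  by rewrite -permM -!eq_porbit_mem (porbit_perm _ 1).
case/andP: lf => /andP[/forallP f_id /forallP f_next] _.
pose A := [set x | (true, x) \in porbit (f * h^-1) u0].
suff AT : A = setT.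
  by case: v0 => j x; rewrite (white j true); have := in_setT x; rewrite -AT inE.
apply: connX => [|x].
  by apply/set0Pn; exists u0.2; rewrite inE (white true u0.1) -surjective_pairing porbit_id.
(* The blacks over [next x] link the whites over [x] to those over [next x]. *)
rewrite !inE => Ax; have /existsP[i /eqP fi] := f_next x.
have /existsP[j /eqP fj] := f_id (next x).
rewrite (white true j) -image [f _]surjective_pairing fj (black _ (f (i, x)).1) -fi.
by rewrite -surjective_pairing image (white i true).
Qed.

(** * Cutting a Hamiltonian cycle into paths *)

Lemma path_traject_avoid (V : finType) (adj : rel V) (T : {pred V}) (f : V -> V) :
  (forall v, v \notin T -> adj v (f v)) ->
  forall k x, (forall a, a < k -> iter a f x \notin T) ->
  path adj x (traject f (f x) k).
Proof.
move=> adjf; elim=> //= k IHk x avoid; rewrite adjf ?(avoid 0) //=.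
by apply: IHk => a ak; rewrite -iterSr; apply: avoid.
Qed.

(** Path [i] follows [g] from [s i] to its first target; only the steps out of targets may fail to
    be edges, and they lead exactly to the sources. *)
Lemma cut_cycle (V : finType) (adj : rel V) (k : nat) (s t : 'I_k -> V) (g : {perm V}) :
  injective s -> injective t ->
  (forall v, (v \in codom t) = (g v \in codom s)) ->
  (forall v, v \notin codom t -> adj v (g v)) ->
  'I_k -> (forall u v, v \in porbit g u) ->
  exists (psi : 'S_k) (p : 'I_k -> seq V),
    [/\ forall i, path adj (s i) (p i) && uniq (s i :: p i),
        forall i, last (s i) (p i) = t (psi i),
        forall i j, i != j -> forall v, v \in s i :: p i -> v \notin s j :: p j
      & forall v, exists i, v \in s i :: p i].
Proof.
move=> inj_s inj_t gts adjg i0 trg.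
(* The [g]-predecessor of [s i] is a target, and it is reached because [g] is a single cycle. *)
have hit i : exists m, iter m g (s i) \in codom t.
  have /porbitP[m Em] := trg (s i) ((g^-1)%g (s i)).
  by exists m; rewrite -permX -Em gts permKV codom_f.
pose K i := ex_minn (hit i).
have hitK i : iter (K i) g (s i) \in codom t by rewrite /K; case: ex_minnP.
have avoid i a : a < K i -> iter a g (s i) \notin codom t.
  by rewrite /K; case: ex_minnP => m _ minm; apply: contraL => /minm; rewrite -leqNgt.
(* Cancelling [a] steps, [s i] is reached from [s j] in [b - a] steps; were this positive, the step
   before would be a target met earlier than [K j]. *)
have meet i j a b : a <= b -> b <= K j -> iter a g (s i) = iter b g (s j) -> i = j /\ a = b.
  move=> ab bK; rewrite -(subnKC ab) iterD -!permX => /perm_inj; rewrite permX.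
  case Ec: (b - a) => [|c]; first by move/inj_s=> ->; rewrite addn0.
  move=> Es; have cK : c < K j by apply: leq_trans bK; rewrite -Ec leq_subr.
  by have := avoid j c cK; rewrite gts -iterS -Es codom_f.
have meet2 i j a b : a <= K i -> b <= K j ->
    iter a g (s i) = iter b g (s j) -> i = j /\ a = b.
  move=> aK bK E; case: (leqP a b) => [ab|/ltnW ba]; first exact: meet E.
  by have [-> ->] := meet _ _ _ _ ba aK (esym E).
have /fin_all_exists[psi psiE] i : exists j, iter (K i) g (s i) = t j.
  by have /codomP := hitK i.
have inj_psi : injective psi.
  move=> i j E; have : iter (K i) g (s i) = iter (K j) g (s j) by rewrite !psiE E.
  by case/meet2.
exists (perm inj_psi), (fun i => traject g (g (s i)) (K i)).
split=> [i|i|i j ij v|v]; rewrite -?trajectS.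
- apply/andP; split; first exact: path_traject_avoid adjg _ _ (@avoid i).
  apply/(uniqP (s i)) => a b; rewrite !inE size_traject !ltnS => aK bK.
  by rewrite !nth_traject ?ltnS // => /meet2[].
- by rewrite last_traject psiE permE.
- case/trajectP=> a; rewrite ltnS => aK ->; apply/negP=> /trajectP[b]; rewrite ltnS => bK.
  by case/meet2=> // Eij; rewrite Eij eqxx in ij.
(* Take a source from which [v] is reached in fewest steps. If its path ended before [v], the step
   after its end would be a source nearer to [v]. *)
have back : exists m, has (fun i => v == iter m g (s i)) (enum 'I_k).
  have /porbitP[m ->] := trg (s i0) v; exists m; apply/hasP; exists i0; last by rewrite permX.
  by rewrite mem_enum.
case: (ex_minnP back) => m /hasP[i _ /eqP vE] minm; exists i; rewrite -trajectS; apply/trajectP; exists m => //.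
rewrite ltnS leqNgt; apply/negP=> Km; have := hitK i; rewrite gts => /codomP[j Ej].
have ltm : m - (K i).+1 < m by rewrite ltn_subrL (leq_trans _ Km).
suff /minm : has (fun j => v == iter (m - (K i).+1) g (s j)) (enum 'I_k) by rewrite leqNgt ltm.
apply/hasP; exists j; first by rewrite mem_enum.
by rewrite -Ej -iterS -iterD subnK // vE.
Qed.

(** * Vertex expansion of products with the directed 4-cycle *)

Lemma I4_ind (P : 'I_4 -> Prop) (c0 : 'I_4) :
  P c0 -> (forall c, P c -> P (c + 1)%R) -> forall c, P c.
Proof.
move=> P0 PS c; rewrite -[c](subrK c0) addrC -[(c - c0)%R]natr_Zp.
elim: (nat_of_ord _) => [|k IHk]; first by rewrite addr0.
by rewrite mulrSr addrA; apply: PS.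
Qed.

Definition product_step (X : finType) (e : rel X) : rel (X * 'I_4) :=
  fun p q => (p.2 == q.2) && e p.1 q.1 || (p.1 == q.1) && (q.2 == p.2 + 1)%R.

Definition expanding (X : finType) (e : rel X) (m : nat) : Prop :=
  forall W : {set X}, W != set0 -> nbhd e W != setT -> #|W| + m <= #|nbhd e W|.

Definition slice (X : finType) (W : {set X * 'I_4}) (c : 'I_4) : {set X} :=
  [set x | (x, c) \in W].

Lemma card_slices (X : finType) (W : {set X * 'I_4}) : #|W| = \sum_c #|slice W c|.
Proof.
rewrite -sum1_card (eq_bigl (fun p => p \in W)) //.
transitivity (\sum_c \sum_(x | (x, c) \in W) 1); last first.
  by apply: eq_bigr => c _; rewrite -sum1_card; apply: eq_bigl => x; rewrite inE.
rewrite (exchange_big_dep predT) //= pair_big_dep /=.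
by apply: eq_bigl => -[].
Qed.

Lemma slice_nbhd (X : finType) (e : rel X) (W : {set X * 'I_4}) c :
  slice (nbhd (product_step e) W) c = nbhd e (slice W c) :|: slice W (c - 1)%R.
Proof.
apply/setP=> y; rewrite in_setU !inE; apply/exists_inP/orP.
  case=> -[x d] xW /orP[] /andP[/=].
    by move=> /eqP <- exy; left; apply/exists_inP; exists x; rewrite ?inE.
  by move=> /eqP <- /eqP->; right; rewrite addrK.
case=> [/exists_inP[x]|yW]; first rewrite inE => xW.
  by move=> exy; exists (x, c) => //; rewrite /product_step /= eqxx exy.
by exists (y, c - 1)%R => //; rewrite /product_step /= eqxx subrK eqxx orbT.
Qed.

Lemma subset_nbhd (X : finType) (e : rel X) (W : {set X}) :
  reflexive e -> W \subset nbhd e W.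
Proof. by move=> e_refl; apply/subsetP=> x xW; apply/nbhdP; exists x. Qed.

(* Sum over the slices [W_c]. If [m + 1] new points are not reached although some
   [W_c] is neither empty nor dominating, then the other slices are closed and
   increasing from [c] on, hence full, which makes slice [c] of [N W] full too.
   Otherwise an empty slice follows a dominating one, which is large. *)
Lemma expanding_product_step (X : finType) (e : rel X) (m : nat) :
  reflexive e -> 0 < m -> expanding e m ->
  (forall W, nbhd e W = setT -> m < #|W|) ->
  expanding (product_step e) m.+1.
Proof.
move=> e_refl m0 expe domin W W0 NW.
pose w := slice W; pose b c := slice (nbhd (product_step e) W) c.
have bE c : b c = nbhd e (w c) :|: w (c - 1)%R := slice_nbhd e W c.
have Nb c : nbhd e (w c) \subset b c by rewrite bE subsetUl.
have wb c : w c \subset b c by apply: subset_trans (Nb c); apply: subset_nbhd.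
have pb c : w (c - 1)%R \subset b c by rewrite bE subsetUr.
rewrite (card_slices W) (card_slices (nbhd _ W)) -/w -/b.
case: (pickP [pred c | (w c != set0) && (nbhd e (w c) != setT)]) => [c|dich].
  case/andP=> wc0 Nc; rewrite leqNgt; apply/negP; rewrite addnS ltnS => small.
  have bc : #|w c| + m <= #|b c| by apply: leq_trans (expe _ wc0 Nc) _; apply: subset_leq_card.
  move: small; rewrite (bigD1 c) //= (bigD1 c (F := fun c => #|w c|)) //= => small.
  have leR (P : pred 'I_4) : \sum_(d | P d) #|w d| <= \sum_(d | P d) #|b d|.
    by apply: leq_sum => d _; apply: subset_leq_card.
  (* Slice [c] alone gains at least [m], and all slices together at most [m]: slice [c] gains
     exactly [m], the others nothing. *)
  have Ebc : #|b c| = #|w c| + m.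
    apply/eqP; rewrite eqn_leq bc andbT -(leq_add2r (\sum_(d < 4 | d != c) #|w d|)).
    apply: leq_trans (leq_trans _ small) _; first by rewrite leq_add2l.
    by rewrite addnAC.
  have stable d : d != c -> b d = w d.
    move=> dc; apply/esym/eqP; rewrite eqEcard wb -(leq_add2l (#|b c| +
       \sum_(i < 4 | (i != c) && (i != d)) #|w i|)).
    apply: leq_trans (leq_trans _ small) _.
      by rewrite [X in _ <= _ + X](bigD1 d) //= -addnA leq_add2l addnC leq_add2l.
    rewrite [in X in X <= _](bigD1 d) //= Ebc.
    by rewrite -!addnA leq_add2l addnA addnC leq_add2l addnC.
  (* A slice that gains nothing contains its own neighbourhood; if nonempty, it is full because
     [m > 0]. *)
  have full d : d != c -> w d != set0 -> w d = setT.
    move=> dc wd0; apply/eqP; apply: contraT => wdT.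
    have Nd : nbhd e (w d) = w d.
      by apply/eqP; rewrite eqEsubset subset_nbhd // andbT -{2}(stable _ dc) Nb.
    by have := expe _ wd0; rewrite Nd wdT => /(_ isT); rewrite -{2}[#|w d|]addn0 leq_add2l leqNgt m0.
  have up d : d != c -> w (d - 1)%R != set0 -> w d = setT.
    move=> dc wd0; apply: full => //; apply: contraNneq wd0 => wd.
    by rewrite -subset0 -wd -(stable _ dc) pb.
  have X0 : [set: X] != set0 by apply: contraNneq wc0 => XT; rewrite -subset0 -XT subsetT.
  have w1 : w (c + 1)%R = setT.
    by apply: up; rewrite ?addrK // -subr_eq0 [(c + _)%R]addrC addrK.
  have w2 : w (c + 1 + 1)%R = setT.
    by apply: up; rewrite ?addrK ?w1 // -addrA -subr_eq0 [(c + _)%R]addrC addrK.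
  have w3 : w (c + 1 + 1 + 1)%R = setT.
    by apply: up; rewrite ?addrK ?w2 // -!addrA -subr_eq0 [(c + _)%R]addrC addrK.
  have E4 : (c + 1 + 1 + 1 = c - 1)%R.
    by rewrite -!addrA; congr (_ + _)%R; apply/val_inj.
  (* Now [b c] is full but has only [#|w c| + m] points, no more than [nbhd e (w c)], which
     contradicts [Nc]. *)
  have := pb c; rewrite -E4 w3 subTset => /eqP bT.
  have := proper_card (_ : nbhd e (w c) \proper setT).
  rewrite properT Nc => /(_ isT); rewrite ltnNge.
  by rewrite -bT Ebc expe.
have Nfull c : w c != set0 -> nbhd e (w c) = setT.
  by move=> wc; apply/eqP; have := dich c; rewrite /= wc => /negbFE.
have [p pW] := set0Pn _ W0; have wp : w p.2 != set0.
  by apply/set0Pn; exists p.1; rewrite inE -surjective_pairing.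
case: (pickP [pred c | (w c == set0) && (w (c - 1)%R != set0)]) => [c|noexit].
  case/andP=> /eqP wc wc1; rewrite (bigD1 c) //= [X in _ <= X](bigD1 c) //=.
  rewrite wc cards0 add0n addnC leq_add //; last by apply: leq_sum => d _; apply: subset_leq_card.
  by apply: leq_trans (domin _ (Nfull _ wc1)) _; apply: subset_leq_card.
case/negP: NW; apply/eqP/setP=> -[x c]; rewrite in_setT.
(* Nonemptiness passes from each slice to the next around [Z_4], so every slice dominates. *)
have allw : w c != set0.
  apply: (@I4_ind (fun c => w c != set0) _ wp) => {}c wc; have := noexit (c + 1)%R; rewrite /= addrK wc andbT.
  by move/negbT.
have := Nb c; rewrite Nfull // subTset => /eqP bT.
by have := in_setT x; rewrite -bT inE.
Qed.

(** * Expansion and Gray code on the torus *)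

Lemma card_nbhd_le (X : finType) (e : rel X) (d : nat) (W : {set X}) :
  (forall x, #|[set y | e x y]| <= d) -> #|nbhd e W| <= #|W| * d.
Proof.
move=> degd; have -> : nbhd e W = \bigcup_(x in W) [set y | e x y].
  apply/setP=> y; apply/nbhdP/bigcupP.
    by case=> x xW exy; exists x; rewrite ?inE.
  by case=> x xW; rewrite inE => exy; exists x.
rewrite -sum_nat_const.
apply: (big_ind2 (fun (A : {set X}) k => #|A| <= k)); first by rewrite cards0.
  by move=> A k B l Ak Bl; apply: leq_trans (leq_card_setU _ _) (leq_add Ak Bl).
by move=> x _; apply: degd.
Qed.

(** [torus m] is [Z_4^(m+1)], the set [X] belonging to [BH_(m+2)]. *)
Fixpoint torus (m : nat) : finType :=
  if m is m'.+1 then (torus m' * 'I_4)%type else 'I_4.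

(** The loops stand for the edges of [BH_n] that change only [a_0]. *)
Fixpoint tadj m : rel (torus m) :=
  match m return rel (torus m) with
  | 0 => fun c d => (c == d) || (d == c + 1)%R
  | m'.+1 => product_step (@tadj m')
  end.

(** The coordinate sum modulo 4, which counts Gray steps. *)
Fixpoint weight m : torus m -> 'I_4 :=
  match m return torus m -> 'I_4 with
  | 0 => id
  | m'.+1 => fun p => (weight p.1 + p.2)%R
  end.

(* The successor of the modular Gray code: it raises the last coordinate, except
   that every fourth step acts on the other coordinates. *)
Fixpoint gray m : torus m -> torus m :=
  match m return torus m -> torus m with
  | 0 => fun c => (c + 1)%R
  | m'.+1 => fun p => if (weight p.1 + p.2 == -1)%R then (gray p.1, p.2)
                      else (p.1, p.2 + 1)%R
  end.

Lemma card_torus m : #|torus m| = 4 ^ m.+1.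
Proof. by elim: m => [|m IHm]; rewrite ?card_prod /= ?IHm card_ord // -expnSr. Qed.

Lemma tadj_refl m : reflexive (@tadj m).
Proof.
by elim: m => [|m IHm] x /=; rewrite /product_step /= ?IHm eqxx.
Qed.

Lemma tadj_degree m (x : torus m) : #|[set y | tadj x y]| <= m.+2.
Proof.
elim: m => [|m IHm] in x *.
  have -> : [set y | tadj x y] = [set x; (x + 1)%R].
    by apply/setP=> y; rewrite !inE /= [x == y]eq_sym.
  by rewrite cards2; case: (_ != _).
case: x => x c; apply: (@leq_trans #|((fun y => (y, c)) @: [set y | tadj x y]) :|: [set (x, c + 1)%R]|).
  apply/subset_leq_card/subsetP=> -[y d]; rewrite !inE /= /product_step /=.
  case/orP=> /andP[/eqP <-] => [exy|/eqP->]; last by rewrite eqxx orbT.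
  by rewrite imset_f // inE.
apply: leq_trans (leq_card_setU _ _) _; rewrite cards1 addn1 ltnS.
exact: leq_trans (leq_imset_card _ _) (IHm x).
Qed.

(** At most [m + 1] points of degree at most [m + 2] reach at most [(m + 1)(m + 2)] points, fewer
    than [4^(m+1)]. *)
Lemma tadj_dominating m (W : {set torus m}) : nbhd (@tadj m) W = setT -> m.+1 < #|W|.
Proof.
move=> NW; rewrite ltnNge; apply/negP=> small.
have := card_nbhd_le W (@tadj_degree m); rewrite NW cardsT card_torus => le4.
have : 4 ^ m.+1 <= m.+1 * m.+2 by apply: leq_trans le4 _; rewrite leq_mul2r small orbT.
rewrite leqNgt => /negP[] {NW small le4 W}.
by elim: m => // m IHm; rewrite expnS; move: IHm; lia.
Qed.

(** Each new coordinate adds one to the expansion. On [Z_4] itself, a set that does not grow is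
    closed under adding 1. *)
Lemma expanding_tadj m : expanding (@tadj m) m.+1.
Proof.
elim: m => [W W0 NW|m IHm]; last first.
  by apply: expanding_product_step => //; [apply: tadj_refl | apply: tadj_dominating].
rewrite addn1 ltnNge; apply: contra NW => le1.
have /eqP NWE : W == nbhd (@tadj 0) W by rewrite eqEcard subset_nbhd //; apply: tadj_refl.
have [c0 c0W] := set0Pn _ W0; apply/eqP/setP=> c; rewrite in_setT.
rewrite -NWE; apply: (@I4_ind (fun c => c \in W) _ c0W) => {}c cW.
by rewrite NWE; apply/nbhdP; exists c; rewrite //= eqxx orbT.
Qed.

Lemma weight_gray m (x : torus m) : weight (gray x) = (weight x + 1)%R.
Proof.
elim: m => // m IHm in x *; case: x => x c /=.
by case: ifP => _ /=; rewrite ?IHm ?addrA // addrAC.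
Qed.

Lemma tadj_gray m (x : torus m) : tadj x (gray x).
Proof.
elim: m => [|m IHm] in x *; first by rewrite /= eqxx orbT.
by case: x => x c /=; rewrite /product_step; case: ifP => _ /=; rewrite ?IHm !eqxx ?orbT.
Qed.

Lemma gray_inj m : injective (@gray m).
Proof.
elim: m => [|m IHm]; first exact: (@addIr 'I_4 1%R).
(* The two branches never collide: [gray] raises the weight by one, so [(y, d)] would have total
   weight [-1] too. *)
have mixed (x y : torus m) (c d : 'I_4) : (weight x + c)%R == (-1)%R ->
    gray x = y -> c = (d + 1)%R -> (weight y + d)%R == (-1)%R.
  by move=> /eqP <- <- ->; rewrite weight_gray -addrA [(1 + d)%R]addrC.
move=> [x c] [y d] /=; case: ifP => xc; case: ifP => yd /pair_equal_spec[Ex Ec].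
- by rewrite (IHm _ _ Ex) Ec.
- by rewrite (mixed x y c d) in yd.
- by rewrite (mixed y x d c) in xc.
by rewrite Ex (addIr _ Ec).
Qed.

Lemma gray_connected m (A : {set torus m}) :
  A != set0 -> (forall x, x \in A -> gray x \in A) -> A = setT.
Proof.
elim: m => [|m IHm] in A *.
  case/set0Pn=> c0 c0A clA; apply/setP=> c; rewrite in_setT.
  exact: (@I4_ind (fun c => c \in A) _ c0A).
case/set0Pn=> -[x0 c0] p0A clA.
(* [P x d] says that the point over [x] of total weight [d] is in [A]. A Gray step raises [d] until
   it is [-1], then passes to [gray x] with [d = 0]; a fibre entered at [0] is thus traversed
   completely. *)
pose P x d := (x, d - weight x)%R \in A.
have up x d : d != (-1)%R -> P x d -> P x (d + 1)%R.
  by move=> d1 /clA /=; rewrite addrC subrK (negPf d1) addrAC.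
have over x : P x (-1)%R -> P (gray x) 0%R.
  by move=> /clA /=; rewrite addrC subrK eqxx /P weight_gray opprD addrA add0r [in X in _ -> X]addrC.
have top x d : P x d -> P x (-1)%R.
  have [k] : exists k, (d + k%:R = -1 :> 'I_4)%R.
    by exists (-1 - d : 'I_4)%R; rewrite natr_Zp addrC subrK.
  elim: k d => [|k IHk] d; first by rewrite addr0 => ->.
  have [-> //|d1 Ed /(up _ _ d1)] := eqVneq d (-1)%R.
  by apply: IHk; rewrite -addrA -mulrS.
have all x d : P x 0%R -> P x d.
  move=> Px; rewrite -[d]natr_Zp; have := ltn_ord d.
  elim: (nat_of_ord d) => // k IHk lek; rewrite mulrSr; apply: up; last exact: IHk (ltnW lek).
  by case: k lek {IHk} => [|[|[|]]].
have PT x : P x 0%R.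
  have E : [set x | P x 0%R] = setT.
    apply: IHm => [|y]; last by rewrite !inE => /(all _ (-1)%R) /over.
    apply/set0Pn; exists (gray x0); rewrite inE; apply/over/(top _ (c0 + weight x0)%R).
    by rewrite /P addrK.
  by have := in_setT x; rewrite -E inE.
apply/setP=> -[x c]; rewrite in_setT.
by have := all x (c + weight x)%R (PT x); rewrite /P addrK.
Qed.

(** * The two matchings *)

(** Let [W] be the projection of [J]. Then [nbhd r J] consists of both twins over [nbhd e W], at
    least [2 #|W| + 2m >= #|J| + k] points, and discarding the [k] targets leaves enough. If
    [nbhd e W] is everything, the complements of sources and targets have equal size. *)
Lemma expanding_matching (X : finType) (e : rel X) (m k : nat)
    (s t : 'I_k -> bool * X) :
  expanding e m -> k <= m.*2 -> injective s -> injective t -> 'I_k ->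
  exists h : {perm bool * X}, (forall i, h (s i) = t i) /\
    forall u, u \notin codom s -> e u.2 (h u).2.
Proof.
move=> expe km inj_s inj_t i0.
pose Sc := s @: 'I_k; pose Tc := t @: 'I_k; pose r := [rel u v : bool * X | e u.2 v.2].
have cSc : #|Sc| = k by rewrite card_imset // card_ord.
have cTc : #|Tc| = k by rewrite card_imset // card_ord.
have [J sJ|f [inj_f fP]] := @hall_marriage _ _ (t i0) r (~: Sc) (~: Tc).
  have [->|J0] := eqVneq J set0; first by rewrite cards0.
  pose W := snd @: J.
  have NJ : nbhd r J = setX setT (nbhd e W).
    apply/setP=> -[b y]; rewrite in_setX in_setT; apply/nbhdP/nbhdP.
      by case=> u uJ euy; exists u.2; rewrite // imset_f.
    by case=> _ /imsetP[u uJ ->] euy; exists u.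
  have [NW|NW] := eqVneq (nbhd e W) setT.
    have -> : nbhd r J = setT by apply/setP=> u; rewrite NJ NW !inE.
    by apply: leq_trans (subset_leq_card sJ) _; rewrite setTI [X in X <= _]cardsCs [X in _ <= X]cardsCs !setCK cSc cTc.
  have cJ : #|J| <= #|W|.*2.
    rewrite -mul2n -card_bool -cardsT -cardsX; apply/subset_leq_card/subsetP=> -[b x] uJ.
    by rewrite in_setX in_setT; apply/imsetP; exists (b, x).
  have W0 : W != set0.
    by have [u uJ] := set0Pn _ J0; apply/set0Pn; exists u.2; rewrite imset_f.
  have cNJ : #|nbhd r J| = #|nbhd e W|.*2 by rewrite NJ cardsX cardsT card_bool mul2n.
  have := expe W W0 NW; have := cardsID (~: Tc) (nbhd r J).
  have := subset_leq_card (_ : nbhd r J :\: ~: Tc \subset Tc).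
  rewrite setDE setCK subsetIr cTc => /(_ isT); lia.
have notS u : (u \notin codom s) = (u \in ~: Sc).
  rewrite inE; congr (~~ _); apply/codomP/imsetP; first by case=> i ->; exists i.
  by case=> i _ ->; exists i.
pose h0 u := if [pick i | s i == u] is Some i then t i else f u.
have h0s i : h0 (s i) = t i.
  rewrite /h0; case: pickP => [j /eqP/inj_s-> //|/(_ i)]; by rewrite eqxx.
have h0f u : u \notin codom s -> h0 u = f u.
  by rewrite /h0; case: pickP => // i /eqP<-; rewrite codom_f.
have fT u i : u \notin codom s -> f u != t i.
  rewrite notS => /fP/andP[]; rewrite inE => fu _.
  by apply: contraNneq fu => ->; rewrite imset_f.
have inj_h : injective h0.
  move=> u v; case: (boolP (u \in codom s)) => [/codomP[i ->]|us];
    case: (boolP (v \in codom s)) => [/codomP[j ->]|vs]; rewrite ?h0s ?h0f //.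
  - by move/inj_t->.
  - by move=> E; have := fT v i vs; rewrite E eqxx.
  - by move=> E; have := fT u j us; rewrite E eqxx.
  by apply: inj_f; rewrite -notS.
exists (perm inj_h); split=> [i|u us]; rewrite permE // h0f //.
by move: us; rewrite notS => /fP/andP[].
Qed.

Lemma lifts_gray m : exists f, lifts_cycle (@tadj m) (@gray m) f.
Proof.
pose f0 (u : bool * torus m) := (u.1, if u.1 then gray u.2 else u.2).
have inj_f : injective f0.
  by move=> [i x] [j y] [<-]; rewrite /=; case: i => [/gray_inj->|->].
exists (perm inj_f); apply/andP; split; first (apply/andP; split).
- by apply/forallP=> x; apply/existsP; exists false; rewrite permE.
- by apply/forallP=> x; apply/existsP; exists true; rewrite permE.
by apply/forallP=> -[[] x]; rewrite permE /= ?tadj_gray ?tadj_refl.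
Qed.

(** * The balanced hypercube as a blow-up of the torus graph *)

Fixpoint coord m : torus m -> nat -> 'I_4 :=
  match m return torus m -> nat -> 'I_4 with
  | 0 => fun c _ => c
  | m'.+1 => fun p i => if i == m'.+1 then p.2 else coord p.1 i
  end.

Lemma coord_inj m (x y : torus m) :
  (forall i, i <= m -> coord x i = coord y i) -> x = y.
Proof.
elim: m => [|m IHm] in x y *; first by move/(_ 0 isT).
case: x y => x c [y d] E; have /= := E _ (leqnn _); rewrite eqxx => ->.
congr pair; apply: IHm => i im; have /= := E _ (leqW im).
by rewrite ltn_eqF.
Qed.

Lemma tadj_coord m (x y : torus m) : tadj x y ->
  (forall i, i <= m -> coord y i = coord x i) \/
  exists2 i, i <= m & coord y i = (coord x i + 1)%R /\
    forall j, j <= m -> j != i -> coord y j = coord x j.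
Proof.
elim: m => [|m IHm] in x y *.
  case/orP=> /eqP->; [by left | right]; exists 0 => //; split=> // j.
  by rewrite leqn0 => ->.
case: x y => x c [y d] /orP[] /andP[/= /eqP<-].
  case/IHm=> [E|[i im [Ei E]]]; [left|right].
    by move=> j; rewrite leq_eqVlt; case: eqP => //= _; apply: E.
  exists i; first exact: leqW; rewrite ltn_eqF //; split=> // j.
  by rewrite leq_eqVlt; case: eqP => //= _; apply: E.
move/eqP->; right; exists m.+1 => //; rewrite eqxx; split=> // j _ /negPf->.
by [].
Qed.

(* Colour, twin and torus point: [a_0 = colour + 2 * twin]. *)
Definition vertex m (v : bool * (bool * torus m)) : bh_vertex m.+2 :=
  [ffun j : 'I_m.+2 => if j == ord0 then inord (v.1 + v.2.1.*2) else coord v.2.2 j.-1].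

Lemma a0_vertex m (v : bool * (bool * torus m)) : a0 (vertex v) = v.1 + v.2.1.*2.
Proof. by rewrite /= ffunE eqxx inordK //; case: v => -[] [[] ?]. Qed.

Lemma odd_a0_vertex m (v : bool * (bool * torus m)) : odd (a0 (vertex v)) = v.1.
Proof. by rewrite a0_vertex oddD odd_double addbF oddb. Qed.

Lemma vertex_coord m (v : bool * (bool * torus m)) (j : 'I_m.+2) :
  0 < j -> vertex v j = coord v.2.2 j.-1.
Proof. by rewrite ffunE; case: eqP => // ->. Qed.

Lemma vertex_inj m : injective (@vertex m).
Proof.
move=> v w E; have E0 : a0 (vertex v) = a0 (vertex w) by rewrite E.
have Ex : v.2.2 = w.2.2.
  apply: coord_inj => i im; have := congr1 (fun u : bh_vertex m.+2 => u (@Ordinal m.+2 i.+1 im)) E.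
  by rewrite !vertex_coord.
move: E0 Ex; rewrite !a0_vertex; case: v w {E} => a [i x] [b [j y]] /= E0 ->.
by case: a b i j E0 => [] [] [] [].
Qed.

Lemma vertex_bij m : bijective (@vertex m).
Proof.
apply: inj_card_bij (@vertex_inj m) _.
by rewrite card_ffun !card_ord !card_prod card_bool card_torus mulnA -expnS.
Qed.

(** An even and an odd first coordinate always differ by one modulo 4, whatever the twins. A torus
    step is [+1] seen from the white end, where [a_0] is even, and [-1] from the black end. *)
Lemma bh_adj_vertex m i j (x y : torus m) : tadj x y ->
  bh_adj (vertex (false, (i, x))) (vertex (true, (j, y))) &&
  bh_adj (vertex (true, (j, y))) (vertex (false, (i, x))).
Proof.
move=> /tadj_coord exy; rewrite /bh_adj /bh_shift !odd_a0_vertex !a0_vertex /=.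
have -> : (1 + j.*2 == m4 (0 + i.*2 + 1)) || (1 + j.*2 == m4 (0 + i.*2 + 3)).
  by case: i; case: j.
have -> : (0 + i.*2 == m4 (1 + j.*2 + 1)) || (0 + i.*2 == m4 (1 + j.*2 + 3)).
  by case: i; case: j.
have lm (l : 'I_m.+2) : l.-1 <= m by case: l => -[].
case: exy => [E|[k km [Ek E]]].
  by apply/andP; split; apply/orP; left; apply/forallP=> l; apply/implyP=> l0;
    rewrite !vertex_coord //= E.
apply/andP; split; apply/orP; right; apply/existsP; exists (@Ordinal m.+2 k.+1 km);
  rewrite !vertex_coord //= Ek; apply/andP; split;
  try (apply/forallP=> l; apply/implyP=> /andP[l0 lk];
    rewrite !vertex_coord //= E //;
    apply: contraNneq lk => lk; apply/eqP/val_inj; rewrite /= -lk prednK //).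
- by [].
- by rewrite /m4 modnDml -addnA modnDr modn_small.
Qed.

(** * Assembling the path cover *)

Lemma porbit_step (V : finType) (g : {perm V}) u v :
  u \in porbit g v -> g u \in porbit g v.
Proof. by rewrite -!eq_porbit_mem (porbit_perm g 1). Qed.

(** The permutation [g0] follows [f] from white to black and [h^-1] back. On whites its square is
    [f * h^-1], so it is a single cycle; it is cut at its steps from [t i] to [s i]. *)
Lemma unpaired_dpc_few_paths (m k : nat) (s t : 'I_k -> bh_vertex m.+2) :
  0 < k -> k <= m.+1.*2 -> injective s -> injective t ->
  (forall i, in_V0 (s i)) -> (forall i, in_V1 (t i)) -> unpaired_dpc s t.
Proof.
move=> k0 km inj_s inj_t s0 t1; have i0 : 'I_k := Ordinal k0.
have [dec vertexK decK] := vertex_bij m.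
pose s' i := (dec (s i)).2; pose t' i := (dec (t i)).2.
have sE i : s i = vertex (false, s' i).
  rewrite -[LHS]decK [dec _]surjective_pairing; congr (vertex (_, _)).
  by have := s0 i; rewrite /in_V0 -{1}[s i]decK odd_a0_vertex => /negPf.
have tE i : t i = vertex (true, t' i).
  rewrite -[LHS]decK [dec _]surjective_pairing; congr (vertex (_, _)).
  by have := t1 i; rewrite /in_V1 -{1}[t i]decK odd_a0_vertex.
have inj_s' : injective s' by move=> i j E; apply: inj_s; rewrite !sE E.
have inj_t' : injective t' by move=> i j E; apply: inj_t; rewrite !tE E.
have [h [hst hadj]] := expanding_matching (@expanding_tadj m) km inj_s' inj_t' i0.
have [f0 lf0] := lifts_gray m.
have [f lf trf] := lifts_cycle_transitive h (@gray_connected m) lf0.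
have fadj u : tadj u.2 (f u).2 by case/andP: lf => _ /forallP.
pose g0 v := vertex (if (dec v).1 then (false, (h^-1)%g (dec v).2)
                     else (true, f (dec v).2)).
have g0w u : g0 (vertex (false, u)) = vertex (true, f u) by rewrite /g0 vertexK.
have g0b u : g0 (vertex (true, u)) = vertex (false, (h^-1)%g u) by rewrite /g0 vertexK.
have inj_g : injective g0.
  move=> v w; rewrite -(decK v) -(decK w).
  case: (dec v) (dec w) => [[] u] [[] u']; rewrite ?g0w ?g0b => /vertex_inj.
  - by move=> /pair_equal_spec[_ /perm_inj->].
  - by [].
  - by [].
  by move=> /pair_equal_spec[_ /perm_inj->].
have gw u : perm inj_g (vertex (false, u)) = vertex (true, f u) by rewrite permE.
have gb u : perm inj_g (vertex (true, u)) = vertex (false, (h^-1)%g u) by rewrite permE.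
have codom_s u : (vertex (false, u) \in codom s) = (u \in codom s').
  apply/codomP/codomP=> -[i]; first by rewrite sE => /vertex_inj[->]; exists i.
  by move=> ->; exists i; rewrite sE.
have codom_t u : (vertex (true, u) \in codom t) = ((h^-1)%g u \in codom s').
  apply/codomP/codomP=> -[i]; rewrite ?tE.
    by move=> /vertex_inj[->]; exists i; rewrite -hst permK.
  by move=> E; exists i; rewrite tE -hst -E permKV.
apply: (@cut_cycle _ _ _ _ _ (perm inj_g)) => //.
- move=> v; rewrite -(decK v); case: (dec v) => -[] u; rewrite ?gb ?gw.
    by rewrite codom_t codom_s.
  transitivity false; [|symmetry]; apply/codomP=> -[i].
    by rewrite tE => /vertex_inj.
  by rewrite sE => /vertex_inj.
- move=> v; rewrite -(decK v); case: (dec v) => -[] u; rewrite ?gb ?gw.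
    rewrite codom_t => /hadj; rewrite permKV.
    case: u ((h^-1)%g u) => j y [i x] /= exy.
    by have /andP[] := bh_adj_vertex i j exy.
  move=> _; have := fadj u; case: u (f u) => i x [j y] /= exy.
  by have /andP[] := bh_adj_vertex i j exy.
pose u0 := s' i0; have base v : v \in porbit (perm inj_g) (vertex (false, u0)).
  have white u : vertex (false, u) \in porbit (perm inj_g) (vertex (false, u0)).
    have /porbitP[l ->] := trf u0 u; elim: l => [|l IHl].
      by rewrite expg0 perm1 porbit_id.
    by rewrite expgSr !permM -gb -gw; do 2!apply: porbit_step.
  rewrite -(decK v); case: (dec v) => -[] u //.
  by rewrite -[u](permKV f) -gw; apply: porbit_step.
move=> u v; rewrite -eq_porbit_mem; have := base u; have := base v.
by rewrite -!eq_porbit_mem => /eqP-> /eqP->.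
Qed.

Theorem theorem8 (n : nat) (hn : 2 <= n)
  (s t : 'I_(2 * n - 2) -> bh_vertex n) :
  injective s -> injective t ->
  (forall i, in_V0 (s i)) -> (forall i, in_V1 (t i)) ->
  unpaired_dpc s t.
Proof.
(* With [n = m + 2], the number [2n - 2] is twice the expansion [m + 1] of the torus. *)
case: n hn s t => [|[|m]] // _ s t inj_s inj_t.
by apply: unpaired_dpc_few_paths => //; lia.
Qed.
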